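(* Let $(Q_h^n)_{n\ge 0}\subset \mathcal T_h^G$ be a sequence satisfying the scheme $$\left\langle \frac{Q_h^{n+1}-Q_h^n}{\Delta t},\varphi\right\rangle = -M\,H^{n+\frac12}(\varphi)\qquad\text{for all }\varphi\in\mathcal T_h^0\text{ and all } n\ge 0,$$ where $H^{n+\frac12}$ is the functional (depending on $Q_h^n$ and $Q_h^{n+1}$) defined in the context. Then for every $n\ge 0$ the discrete energy dissipation law $$\frac{\mathcal F(Q_h^{n+1})-\mathcal F(Q_h^n)}{\Delta t} = -\frac1M\left\|\frac{Q_h^{n+1}-Q_h^n}{\Delta t}\right\|^2$$ holds, where $\|\cdot\|$ is the $L^2(\Omega)$ norm.
   Context: Setting and parameters. $\Omega\subset\mathbb R^3$ is a bounded domain with a (quasi-uniform) triangulation $\Omega_h$ with elements $\Omega_1,\dots,\Omega_L$ and maximum element diameter $h$. $\mathcal S=\{Q\in\mathbb R^{3\times3}: Q^\top=Q,\ \mathrm{tr}\,Q=0\}$. Constants: $L_1,L_2,L_3,L_4>0$, $L_5\ge 0$, $M>0$, $\Delta t>0$, $a,b\in\mathbb R$, $c>0$, with $a<\frac{b^2}{27c}$, and $s_0=\frac{b+\sqrt{b^2-24ac}}{4c}$. The boundary datum is $G:\partial\Omega\to\mathcal S$. Notation. $A:B=\sum_{i,j}A_{ij}B_{ij}$, $|A|=\sqrt{A:A}$; $A_{ij,k}=\partial A_{ij}/\partial x_k$, $\nabla A:\nabla B=\sum_{i,j,k}A_{ij,k}B_{ij,k}$, $|\nabla A|=\sqrt{\nabla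 A:\nabla A}$. For a matrix field $A$ with rows $A_1,A_2,A_3$, $\mathrm{div}\,A$ is the vector whose $j$-th entry is $\mathrm{div}\,A_j$, and $\mathrm{curl}\,A$ is the matrix whose $j$-th column is $\mathrm{curl}\,A_j$. $\langle\cdot,\cdot\rangle$ denotes the $L^2(\Omega)$ inner product of scalar, vector, matrix fields or gradients of matrix fields (using the pointwise products above) and $\|\cdot\|$ the associated norm. Products such as $S\,\mathrm{div}\,Q$, $S\,\mathrm{curl}\,Q$, $\varphi\,\mathrm{div}\,Q$ are matrix-vector or matrix-matrix products. Finite element sets. $G_h:\Omega\to\mathcal S$ is the continuous function, affine on each element, equal to $0$ at every interior node and to $G(P)$ at every boundary node $P$. $\mathcal T_h^0$ is the space of continuous $\varphi:\Omega\to\mathcal S$ that are affine on each element and vanish on $\partial\Omega$; $\mathcal T_h^G=\{\varphi+G_h:\varphi\in\mathcal T_h^0\}$. Energy. $S_1(Q)=\frac{s_0}{3}I+Q$, $S_2(Q)=\frac{2s_0}{3}I-Q$, $W(Q)=a\,\mathrm{tr}(Q^2)-\frac{2b}{3}\mathrm{tr}(Q^3)+\frac c2(\mathrm{tr}(Q^2))^2$, and $$\mathcal F(Q)=\int_\Omega\Big(\tfrac{L_1}2|S_1(Q)\,\mathrm{div}\,Q|^2+\tfrac{L_2}2|S_1(Q)\,\mathrm{curl}\,Q|^2+\tfrac{L_3}2|S_2(Q)\,\mathrm{div}\,Q|^2+\tfrac{L_4}2|S_2(Q)\,\mathrm{curl}\,Q|^2+\tfrac{L_5}2|Q|^2|\nabla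 Q|^2+W(Q)\Big)dx.$$ Scheme. For any time-indexed quantity, $(\cdot)^{n+\frac12}=\frac12\big((\cdot)^{n+1}+(\cdot)^n\big)$; this averaging is applied to the whole expression in parentheses, e.g. $(S_{1,h}\,\mathrm{div}\,Q_h)^{n+\frac12}=\frac12(S_{1,h}^{n+1}\mathrm{div}\,Q_h^{n+1}+S_{1,h}^n\,\mathrm{div}\,Q_h^n)$, where $S_{i,h}^n=S_i(Q_h^n)$. Then $H^{n+\frac12}=\sum_{i=1}^6H_i^{n+\frac12}$ with - $H_1^{n+\frac12}(\varphi)=L_1\langle(S_{1,h}\,\mathrm{div}\,Q_h)^{n+\frac12},\,S_{1,h}^{n+\frac12}\,\mathrm{div}\,\varphi+\varphi\,\mathrm{div}\,Q_h^{n+\frac12}\rangle$, - $H_2^{n+\frac12}(\varphi)=L_2\langle(S_{1,h}\,\mathrm{curl}\,Q_h)^{n+\frac12},\,S_{1,h}^{n+\frac12}\,\mathrm{curl}\,\varphi+\varphi\,\mathrm{curl}\,Q_h^{n+\frac12}\rangle$, - $H_3^{n+\frac12}(\varphi)=L_3\langle(S_{2,h}\,\mathrm{div}\,Q_h)^{n+\frac12},\,S_{2,h}^{n+\frac12}\,\mathrm{div}\,\varphi-\varphi\,\mathrm{div}\,Q_h^{n+\frac12}\rangle$, - $H_4^{n+\frac12}(\varphi)=L_4\langle(S_{2,h}\,\mathrm{curl}\,Q_h)^{n+\frac12},\,S_{2,h}^{n+\frac12}\,\mathrm{curl}\,\varphi-\varphi\,\mathrm{curl}\,Q_h^{n+\frac12}\rangle$,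 - $H_5^{n+\frac12}(\varphi)=L_5\big(\langle(|\nabla Q_h|^2)^{n+\frac12}Q_h^{n+\frac12},\varphi\rangle+\langle(|Q_h|^2)^{n+\frac12}\nabla Q_h^{n+\frac12},\nabla\varphi\rangle\big)$, - $H_6^{n+\frac12}(\varphi)=\big\langle 2aQ_h^{n+\frac12}-\tfrac{2b}3\big(2(Q_h^2)^{n+\frac12}+Q_h^{n+1}Q_h^n\big)+2c\,(\mathrm{tr}(Q_h^2))^{n+\frac12}Q_h^{n+\frac12},\,\varphi\big\rangle$. *)

(* Defs.v *)
From HB Require Import structures.
From mathcomp Require Import all_boot all_order all_algebra.
From mathcomp Require Import all_classical all_reals all_analysis.

Set Implicit Arguments.
Unset Strict Implicit.
Unset Printing Implicit Defensive.

Import Order.TTheory GRing.Theory Num.Theory.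
Import numFieldNormedType.Exports.

Local Open Scope classical_set_scope.
Local Open Scope ring_scope.

Definition R3 (R : realType) := 'rV[R]_3.

(* A field on Omega is a total function on R^3; only its values on the closure
   of Omega are ever constrained or used. *)
Definition mxfield (R : realType) := R3 R -> 'M[R]_3.

(* On 'cV[R]_3 this is the Euclidean dot product. *)
Definition frob (R : realType) (m n : nat) (A B : 'M[R]_(m, n)) : R :=
  \sum_i \sum_j A i j * B i j.

Definition fnorm (R : realType) (m n : nat) (A : 'M[R]_(m, n)) : R :=
  Num.sqrt (frob A A).

(* Third-order tensors T_{ij,k}, stored as k |-> (T_{ij,k})_{ij}. *)
Definition tensor (R : realType) := {ffun 'I_3 -> 'M[R]_3}.

Definition tdot (R : realType) (T U : tensor R) : R := \sum_k frob (T k) (U k).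

Definition tnorm (R : realType) (T : tensor R) : R := Num.sqrt (tdot T T).

Definition sym_traceless (R : realType) (A : 'M[R]_3) : Prop :=
  A^T = A /\ \tr A = 0.

(* The fields of interest are only piecewise smooth: the derivatives below are
   classical where they exist, which is almost everywhere; their default values
   on element interfaces do not affect integrals. *)
Definition partial (R : realType) (k : 'I_3) (f : R3 R -> R) (x : R3 R)
    : R := 'D_(delta_mx 0 k) f x.

Definition grad (R : realType) (A : mxfield R) (x : R3 R) : tensor R :=
  [ffun k => \matrix_(i, j) partial k (fun y => A y i j) x].

Definition div_vec (R : realType) (v : R3 R -> 'rV[R]_3) (x : R3 R) : R :=
  \sum_k partial k (fun y => v y 0 k) x.

(* Index arithmetic is modulo 3: (curl v)_i = d_{i+1} v_{i+2} - d_{i+2} v_{i+1}. *)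
Definition curl_vec (R : realType) (v : R3 R -> 'rV[R]_3) (x : R3 R)
    : 'cV[R]_3 :=
  \col_i (partial (i + 1) (fun y => v y 0 (i + 2)) x -
          partial (i + 2) (fun y => v y 0 (i + 1)) x).

Definition div_mx (R : realType) (A : mxfield R) (x : R3 R) : 'cV[R]_3 :=
  \col_j div_vec (fun y => row j (A y)) x.

Definition curl_mx (R : realType) (A : mxfield R) (x : R3 R) : 'M[R]_3 :=
  \matrix_(i, j) curl_vec (fun y => row j (A y)) x i 0.

Definition vec3 (R : realType) (p : R * R * R) : R3 R :=
  \row_(k < 3) [:: p.1.1; p.1.2; p.2]`_k.

Definition integral_on (R : realType) (Omega : set (R3 R))
    (f : R3 R -> R) : R :=
  \int[((@lebesgue_measure R \x @lebesgue_measure R) \x @lebesgue_measure R)%E]_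
    (p in @vec3 R @^-1` Omega) f (vec3 p).

Definition inner (R : realType) (Omega : set (R3 R)) (m n : nat)
    (A B : R3 R -> 'M[R]_(m, n)) : R :=
  integral_on Omega (fun x => frob (A x) (B x)).

Definition inner_tensor (R : realType) (Omega : set (R3 R))
    (T U : R3 R -> tensor R) : R :=
  integral_on Omega (fun x => tdot (T x) (U x)).

Definition L2norm (R : realType) (Omega : set (R3 R)) (m n : nat)
    (A : R3 R -> 'M[R]_(m, n)) : R :=
  Num.sqrt (inner Omega A A).

Definition boundary (R : realType) (Omega : set (R3 R)) : set (R3 R) :=
  closure Omega `\` interior Omega.

Definition bounded_domain (R : realType) (Omega : set (R3 R)) : Prop :=
  [/\ Omega !=set0, open Omega, connected Omega & bounded_set Omega].

(* Convex hull of the vertices v i, i \in J. *)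
Definition face (R : realType) (v : 'I_4 -> R3 R) (J : {set 'I_4})
    : set (R3 R) :=
  [set x | exists w : 'I_4 -> R,
     [/\ forall i, 0 <= w i, forall i, i \notin J -> w i = 0,
         \sum_i w i = 1 & x = \sum_i w i *: v i]].

Definition tetrahedron (R : realType) (v : 'I_4 -> R3 R) : set (R3 R) :=
  face v [set: 'I_4]%SET.

Record triangulation (R : realType) (Omega : set (R3 R)) (L : nat)
    (v : 'I_L -> 'I_4 -> R3 R) : Prop := Triangulation {
  tri_nondegenerate : forall l,
    \det (\matrix_(i < 3) (v l (lift ord0 i) - v l ord0)) != 0;
  tri_cover : closure Omega = \bigcup_(l in [set: 'I_L]) tetrahedron (v l);
  tri_interior : forall l, interior (tetrahedron (v l)) `<=` Omega;
  tri_disjoint : forall l m, l != m ->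
    interior (tetrahedron (v l)) `&` interior (tetrahedron (v m)) = set0;
  tri_conforming : forall l m, l != m ->
    tetrahedron (v l) `&` tetrahedron (v m) =
    face (v l) [set i | [exists j, v l i == v m j]]%SET }.

Definition diameter (R : realType) (T : set (R3 R)) : R :=
  sup [set fnorm (x - y) | x in T & y in T].

Definition mesh_size (R : realType) (L : nat) (v : 'I_L -> 'I_4 -> R3 R)
    : R := \big[Num.max/0]_(l < L) diameter (tetrahedron (v l)).

(* Every element contains a Euclidean ball of diameter at least kappa * h. *)
Definition quasi_uniform (R : realType) (kappa : R) (L : nat)
    (v : 'I_L -> 'I_4 -> R3 R) : Prop :=
  forall l, exists x0 r, kappa * mesh_size v <= 2 * r /\
    [set x | fnorm (x - x0) <= r] `<=` tetrahedron (v l).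

Definition affine_on (R : realType) (T : set (R3 R)) (A : mxfield R) : Prop :=
  exists (u : {linear R3 R -> 'M[R]_3}) (d : 'M[R]_3),
    forall x, T x -> A x = u x + d.

Definition P1_field (R : realType) (Omega : set (R3 R)) (L : nat)
    (v : 'I_L -> 'I_4 -> R3 R) (A : mxfield R) : Prop :=
  [/\ {within closure Omega, continuous A},
      forall x, closure Omega x -> sym_traceless (A x) &
      forall l, affine_on (tetrahedron (v l)) A].

Definition is_boundary_lift (R : realType) (Omega : set (R3 R)) (L : nat)
    (v : 'I_L -> 'I_4 -> R3 R) (G Gh : mxfield R) : Prop :=
  P1_field Omega v Gh /\
  forall l i, (Omega (v l i) -> Gh (v l i) = 0) /\
              (boundary Omega (v l i) -> Gh (v l i) = G (v l i)).

Definition T0 (R : realType) (Omega : set (R3 R)) (L : nat)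
    (v : 'I_L -> 'I_4 -> R3 R) : set (mxfield R) :=
  [set phi | P1_field Omega v phi /\ forall x, boundary Omega x -> phi x = 0].

Definition TG (R : realType) (Omega : set (R3 R)) (L : nat)
    (v : 'I_L -> 'I_4 -> R3 R) (Gh : mxfield R) : set (mxfield R) :=
  [set (fun x => phi x + Gh x) | phi in T0 Omega v].

Definition s_eq (R : realType) (a b c : R) : R :=
  (b + Num.sqrt (b ^+ 2 - 24 * a * c)) / (4 * c).

Definition S1 (R : realType) (s0 : R) (Q : 'M[R]_3) : 'M[R]_3 :=
  (s0 / 3) *: 1%:M + Q.

Definition S2 (R : realType) (s0 : R) (Q : 'M[R]_3) : 'M[R]_3 :=
  (2 * s0 / 3) *: 1%:M - Q.

Definition bulk (R : realType) (a b c : R) (Q : 'M[R]_3) : R :=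
  a * \tr (Q ^+ 2) - 2 * b / 3 * \tr (Q ^+ 3) + c / 2 * (\tr (Q ^+ 2)) ^+ 2.

Definition energy (R : realType) (Omega : set (R3 R))
    (L1 L2 L3 L4 L5 a b c : R) (Q : mxfield R) : R :=
  let s0 := s_eq a b c in
  integral_on Omega (fun x =>
    L1 / 2 * fnorm (S1 s0 (Q x) *m div_mx Q x) ^+ 2
  + L2 / 2 * fnorm (S1 s0 (Q x) *m curl_mx Q x) ^+ 2
  + L3 / 2 * fnorm (S2 s0 (Q x) *m div_mx Q x) ^+ 2
  + L4 / 2 * fnorm (S2 s0 (Q x) *m curl_mx Q x) ^+ 2
  + L5 / 2 * fnorm (Q x) ^+ 2 * tnorm (grad Q x) ^+ 2
  + bulk a b c (Q x)).

(* The average (.)^{n+1/2} of a time-indexed field. *)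
Definition midpoint (R : realType) (V : lmodType R) (u : nat -> R3 R -> V)
    (n : nat) (x : R3 R) : V :=
  2^-1 *: (u n.+1 x + u n x).

Definition H1 (R : realType) (Omega : set (R3 R)) (L1 s0 : R)
    (Q : nat -> mxfield R) (n : nat) (phi : mxfield R) : R :=
  L1 * inner Omega
    (midpoint (fun m x => S1 s0 (Q m x) *m div_mx (Q m) x) n)
    (fun x => midpoint (fun m y => S1 s0 (Q m y)) n x *m div_mx phi x +
              phi x *m div_mx (midpoint Q n) x).

Definition H2 (R : realType) (Omega : set (R3 R)) (L2 s0 : R)
    (Q : nat -> mxfield R) (n : nat) (phi : mxfield R) : R :=
  L2 * inner Omega
    (midpoint (fun m x => S1 s0 (Q m x) *m curl_mx (Q m) x) n)
    (fun x => midpoint (fun m y => S1 s0 (Q m y)) n x *m curl_mx phi x +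
              phi x *m curl_mx (midpoint Q n) x).

Definition H3 (R : realType) (Omega : set (R3 R)) (L3 s0 : R)
    (Q : nat -> mxfield R) (n : nat) (phi : mxfield R) : R :=
  L3 * inner Omega
    (midpoint (fun m x => S2 s0 (Q m x) *m div_mx (Q m) x) n)
    (fun x => midpoint (fun m y => S2 s0 (Q m y)) n x *m div_mx phi x -
              phi x *m div_mx (midpoint Q n) x).

Definition H4 (R : realType) (Omega : set (R3 R)) (L4 s0 : R)
    (Q : nat -> mxfield R) (n : nat) (phi : mxfield R) : R :=
  L4 * inner Omega
    (midpoint (fun m x => S2 s0 (Q m x) *m curl_mx (Q m) x) n)
    (fun x => midpoint (fun m y => S2 s0 (Q m y)) n x *m curl_mx phi x -
              phi x *m curl_mx (midpoint Q n) x).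

Definition H5 (R : realType) (Omega : set (R3 R)) (L5 : R)
    (Q : nat -> mxfield R) (n : nat) (phi : mxfield R) : R :=
  L5 *
  (inner Omega
     (fun x => midpoint (fun m y => tnorm (grad (Q m) y) ^+ 2 : R^o) n x
               *: midpoint Q n x) phi +
   inner_tensor Omega
     (fun x => midpoint (fun m y => fnorm (Q m y) ^+ 2 : R^o) n x
               *: grad (midpoint Q n) x) (grad phi)).

Definition H6 (R : realType) (Omega : set (R3 R)) (a b c : R)
    (Q : nat -> mxfield R) (n : nat) (phi : mxfield R) : R :=
  inner Omega
    (fun x => (2 * a) *: midpoint Q n x
      - (2 * b / 3) *: (2 *: midpoint (fun m y => Q m y ^+ 2) n x
                        + Q n.+1 x *m Q n x)
      + (2 * c * midpoint (fun m y => \tr (Q m y ^+ 2) : R^o) n x) *: midpoint Q n x)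
    phi.

Definition Hfun (R : realType) (Omega : set (R3 R))
    (L1 L2 L3 L4 L5 a b c : R) (Q : nat -> mxfield R) (n : nat)
    (phi : mxfield R) : R :=
  let s0 := s_eq a b c in
  H1 Omega L1 s0 Q n phi + H2 Omega L2 s0 Q n phi + H3 Omega L3 s0 Q n phi
  + H4 Omega L4 s0 Q n phi + H5 Omega L5 Q n phi + H6 Omega a b c Q n phi.

Definition difference_quotient (R : realType) (dt : R) (Q : nat -> mxfield R)
    (n : nat) : mxfield R :=
  fun x => dt^-1 *: (Q n.+1 x - Q n x).

(* Main.v *)
Require Import Defs.
From HB Require Import structures.
From mathcomp Require Import all_boot all_order all_algebra.
From mathcomp Require Import all_classical all_reals all_analysis.
From mathcomp Require Import measurable_realfun.
From mathcomp Require Import ring.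
Import Order.TTheory GRing.Theory Num.Theory.
Import numFieldNormedType.Exports.
Local Open Scope classical_set_scope.
Local Open Scope ring_scope.

Set Implicit Arguments.
Unset Strict Implicit.
Unset Printing Implicit Defensive.

(** Test the scheme with the difference quotient of two successive iterates.  It
    is an admissible test function because both iterates contain the same
    boundary lift ([TG_difference_quotient]), and it turns the left-hand side
    into the squared L2 norm of the dissipation law.  What remains is that H,
    tested this way, is exactly the difference quotient of the energy
    ([Hfun_increment]).

    At almost every point this is algebra.  Each density is a product, and the
    averages in H are arranged so that the discrete product rule
    (mean of S)(increment of D) + (increment of S)(mean of D) = increment of SD
    applies without remainder; paired with the average of SD it gives half the
    increment of |SD|^2 ([weighted_square_increment]).  The term with |Q|^2 and
    |grad Q|^2 is the scalar version ([quartic_increment]).  For the bulk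
    potential, a difference of squares handles the terms in tr Q^2, and
    A^2 + B^2 + AB against A - B gives the increment of tr Q^3 by cyclicity of
    the trace ([bulk_increment]).

    The algebra needs div, curl and grad to be linear and the integrals to be
    additive.  Inside an element the fields are affine, so their derivatives
    exist, are constant and depend linearly on the field ([partial_affine]).
    On the interfaces the derivatives have default values about which nothing,
    not even measurability, is known.  The interfaces lie in finitely many
    planes, hence in a null set ([tetrahedron_boundary_null]), and a null set
    may be removed from the domain of integration of an arbitrary function
    ([integral_ignore_null]).  On the rest every integrand is a polynomial in
    bounded measurable functions over a set of finite volume, so it is
    integrable. *)

(** * Discrete product rules for matrices *)

Lemma frobE (R : realType) (m n : nat) (A B : 'M[R]_(m, n)) :
  frob A B = \tr (A *m B^T).
Proof.
apply: eq_bigr => i _; rewrite mxE; apply: eq_bigr => j _; by rewrite mxE.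
Qed.

Lemma frobDl (R : realType) (m n : nat) (A B C : 'M[R]_(m, n)) :
  frob (A + B) C = frob A C + frob B C.
Proof. by rewrite !frobE mulmxDl mxtraceD. Qed.

Lemma frobZl (R : realType) (m n : nat) (k : R) (A B : 'M[R]_(m, n)) :
  frob (k *: A) B = k * frob A B.
Proof. by rewrite !frobE -scalemxAl mxtraceZ. Qed.

Lemma frobC (R : realType) (m n : nat) (A B : 'M[R]_(m, n)) :
  frob A B = frob B A.
Proof. by rewrite !frobE -mxtrace_tr trmx_mul trmxK. Qed.

Lemma frobDr (R : realType) (m n : nat) (A B C : 'M[R]_(m, n)) :
  frob A (B + C) = frob A B + frob A C.
Proof. by rewrite frobC frobDl !(frobC A). Qed.

Lemma frobZr (R : realType) (m n : nat) (k : R) (A B : 'M[R]_(m, n)) :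
  frob A (k *: B) = k * frob A B.
Proof. by rewrite frobC frobZl frobC. Qed.

Lemma frobNr (R : realType) (m n : nat) (A B : 'M[R]_(m, n)) :
  frob A (- B) = - frob A B.
Proof. by rewrite -scaleN1r frobZr mulN1r. Qed.

Lemma frobNl (R : realType) (m n : nat) (A B : 'M[R]_(m, n)) :
  frob (- A) B = - frob A B.
Proof. by rewrite frobC frobNr frobC. Qed.

Lemma frob_ge0 (R : realType) (m n : nat) (A : 'M[R]_(m, n)) : 0 <= frob A A.
Proof.
by apply: sumr_ge0 => i _; apply: sumr_ge0 => j _; rewrite -expr2 sqr_ge0.
Qed.

Lemma fnorm_sqr (R : realType) (m n : nat) (A : 'M[R]_(m, n)) :
  fnorm A ^+ 2 = frob A A.
Proof. by rewrite sqr_sqrtr ?frob_ge0. Qed.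

Lemma tdot_ge0 (R : realType) (T : tensor R) : 0 <= tdot T T.
Proof. by apply: sumr_ge0 => k _; exact: frob_ge0. Qed.

Lemma tnorm_sqr (R : realType) (T : tensor R) : tnorm T ^+ 2 = tdot T T.
Proof. by rewrite sqr_sqrtr ?tdot_ge0. Qed.

Lemma frob_difference_of_squares (R : realType) (m n : nat)
  (A B : 'M[R]_(m, n)) :
  frob (A + B) (A - B) = frob A A - frob B B.
Proof. by rewrite frobDl !frobDr !frobNr (frobC B A); ring. Qed.

Lemma tdot_difference_of_squares (R : realType) (k l : R) (T U : tensor R) :
  tdot (k *: (T + U)) (l *: (T - U)) = k * l * (tdot T T - tdot U U).
Proof.
rewrite /tdot -sumrB mulr_sumr; apply: eq_bigr => i _.
rewrite !ffunE frobZl frobZr mulrA; congr (_ * _).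
exact: frob_difference_of_squares.
Qed.

(** The discrete Leibniz rule behind the scheme: averaging one factor while
    differencing the other, in both ways, produces an exact difference of
    products, with no remainder. *)
Lemma discrete_product_rule (R : realType) (m n p : nat)
  (S' S : 'M[R]_(m, n)) (D' D : 'M[R]_(n, p)) :
  (2^-1 *: (S' + S)) *m (D' - D) + (S' - S) *m (2^-1 *: (D' + D)) =
  S' *m D' - S *m D.
Proof.
rewrite -scalemxAl -scalemxAr -scalerDr.
rewrite !mulmxDl !mulmxDr !mulmxN !mulNmx.
move: (S' *m D') (S' *m D) (S *m D') (S *m D) => P1 P2 P3 P4.
by apply/matrixP => i j; rewrite !mxE; field.
Qed.

(** The first four energy densities are squares of products: pair the averaged
    product with the increment given by [discrete_product_rule], then use that
    a sum paired with a difference is a difference of squares. *)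
Lemma weighted_square_increment (R : realType) (m n p : nat) (k : R)
  (S' S : 'M[R]_(m, n)) (D' D : 'M[R]_(n, p)) :
  frob (2^-1 *: (S' *m D' + S *m D))
       ((2^-1 *: (S' + S)) *m (k *: (D' - D)) +
        (k *: (S' - S)) *m (2^-1 *: (D' + D))) =
  k / 2 * (fnorm (S' *m D') ^+ 2 - fnorm (S *m D) ^+ 2).
Proof.
rewrite -(scalemxAr k) -(scalemxAl k (S' - S)) -(scalerDr k) discrete_product_rule.
by rewrite frobZl frobZr frob_difference_of_squares !fnorm_sqr; field.
Qed.

(** Since the matrices do not commute, A^2 + B^2 + AB times A - B telescopes only
    under the trace, where cyclicity identifies the mixed cubic terms. *)
Lemma trace_cube_increment (R : realType) (A B : 'M[R]_3) :
  \tr ((A ^+ 2 + B ^+ 2 + A *m B) *m (A - B)) = \tr (A ^+ 3) - \tr (B ^+ 3).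
Proof.
rewrite !mulmxDl !mulmxDr !mulmxN !mxtraceD !linearN /=.
have E2 (C : 'M[R]_3) : C ^+ 2 = C *m C by [].
have E3 (C : 'M[R]_3) : C ^+ 3 = C *m C *m C by rewrite exprSr.
rewrite !E2 !E3.
rewrite (mxtrace_mulC (A *m B) A) (mxtrace_mulC (B *m B) A) !mulmxA; ring.
Qed.

(** Again the Leibniz rule, for the scalars |Q|^2 and |grad Q|^2: each increment of
    one of them is weighted by the average of the other. *)
Lemma quartic_increment (R : realType) (k : R) (A B : 'M[R]_3) (T U : tensor R) :
  frob ((2^-1 * (tnorm T ^+ 2 + tnorm U ^+ 2)) *: (2^-1 *: (A + B)))
       (k *: (A - B)) +
  tdot ((2^-1 * (fnorm A ^+ 2 + fnorm B ^+ 2)) *: (2^-1 *: (T + U)))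
       (k *: (T - U)) =
  k / 2 * (fnorm A ^+ 2 * tnorm T ^+ 2 - fnorm B ^+ 2 * tnorm U ^+ 2).
Proof.
rewrite !scalerA tdot_difference_of_squares frobZl frobZr.
by rewrite frob_difference_of_squares !fnorm_sqr !tnorm_sqr; field.
Qed.

(** Symmetry of the matrices turns the Frobenius products into the traces that
    occur in the bulk potential. *)
Lemma bulk_increment (R : realType) (a b c k : R) (A B : 'M[R]_3) :
  A^T = A -> B^T = B ->
  frob ((2 * a) *: (2^-1 *: (A + B))
        - (2 * b / 3) *: (2 *: (2^-1 *: (A ^+ 2 + B ^+ 2)) + A *m B)
        + (2 * c * (2^-1 * (\tr (A ^+ 2) + \tr (B ^+ 2)))) *:
            (2^-1 *: (A + B)))
       (k *: (A - B)) = k * (bulk a b c A - bulk a b c B).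
Proof.
move=> sA sB.
have sq (C : 'M[R]_3) : C^T = C -> frob C C = \tr (C ^+ 2).
  by move=> sC; rewrite frobE sC.
have cube : frob (A ^+ 2 + B ^+ 2 + A *m B) (A - B) = \tr (A ^+ 3) - \tr (B ^+ 3).
  by rewrite frobE linearB /= sA sB trace_cube_increment.
have -> : 2 *: (2^-1 *: (A ^+ 2 + B ^+ 2)) = A ^+ 2 + B ^+ 2 :> 'M[R]_3.
  by rewrite scalerA divff ?pnatr_eq0// scale1r.
move: (A ^+ 2 + B ^+ 2 + A *m B) cube => C cube.
rewrite (frobDl (_ - _)) (frobDl _ (- _)) frobNl !frobZr !frobZl cube.
rewrite frob_difference_of_squares !sq //.
by rewrite /bulk; field.
Qed.

(** * Integrals and null sets *)

Section IgnoreNull.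
Import HBNNSimple.

Lemma sintegral_setD_null d (T : measurableType d) (R : realType)
  (mu : {measure set T -> \bar R}) (N : set T) (mN : measurable N)
  (h : {nnsfun T >-> R}) :
  mu N = 0%E ->
  sintegral mu (h \_ (~` N)) = sintegral mu h.
Proof.
move=> N0; have mC : measurable (~` N) by exact: measurableC.
rewrite -(integral_nnsfun mu mC).
have -> : sintegral mu h = sintegral mu (h \_ setT) by rewrite patch_setT.
rewrite -(integral_nnsfun mu measurableT) -(setvU N).
have mh A : measurable_fun A (EFin \o h : T -> \bar R).
  by apply/measurable_EFinP; exact: measurable_funTS.
rewrite (ge0_integral_setU mu mC mN) //; last 2 first.
- by move=> x _; rewrite /= lee_fin.
- by rewrite disj_set2E setICl.
rewrite [X in (_ + X)%E](_ : _ = 0%E) ?adde0 //.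
rewrite -(@integral_abs_eq0 _ _ _ mu N (EFin \o h)) //.
by apply: eq_integral => x _; rewrite /= ger0_norm.
Qed.

(** The integral of a nonnegative function is a supremum of integrals of simple
    functions below it; cutting such a simple function off on the null set
    changes neither its integral nor its admissibility.  Arguing with this lower
    integral covers functions that are not measurable, such as densities built
    from derivatives with default values on the interfaces between elements. *)
Lemma ge0_integral_ignore_null d (T : measurableType d) (R : realType)
  (mu : {measure set T -> \bar R}) (N D D' : set T) (f : T -> \bar R) :
  measurable N -> mu N = 0%E -> D' `<=` D -> D `<=` D' `|` N ->
  (forall x, 0 <= f x)%E ->
  (\int[mu]_(x in D) f x = \int[mu]_(x in D') f x)%E.
Proof.
move=> mN N0 D'D DD' f0; rewrite !ge0_integralE//.
have mC : measurable (~` N) by exact: measurableC.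
apply/eqP; rewrite eq_le; apply/andP; split.
  apply: ge_ereal_sup => _ [h hf <-]; apply: ereal_sup_ubound.
  exists (proj_nnsfun h mC); last first.
    by rewrite -mrestrict; exact: sintegral_setD_null.
  move=> x; rewrite -mrestrict /=; have := hf x; rewrite /patch /=.
  have [xN|xN] := boolP (x \in ~` N); last first.
    by move=> _; case: ifP.
  have [xD|xD] := boolP (x \in D); have [xD'|xD'] := boolP (x \in D') => //.
    move: xN xD xD'; rewrite !inE => xN /DD' [xD'|//].
    by rewrite notin_setE.
  by move=> /le_trans; apply.
apply: ge_ereal_sup => _ [h hf <-]; apply: ereal_sup_ubound.
exists h => // x; apply: (le_trans (hf x)).
by apply: restrict_lee => // y _.
Qed.

End IgnoreNull.

Lemma integral_ignore_null d (T : measurableType d) (R : realType)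
  (mu : {measure set T -> \bar R}) (N D D' : set T) (f : T -> \bar R) :
  measurable N -> mu N = 0%E -> D' `<=` D -> D `<=` D' `|` N ->
  (\int[mu]_(x in D) f x = \int[mu]_(x in D') f x)%E.
Proof.
move=> mN N0 D'D DD'; rewrite integralE [in RHS]integralE.
by congr (_ - _)%E; apply: ge0_integral_ignore_null mN N0 D'D DD' _ => x;
  [exact: funepos_ge0|exact: funeneg_ge0].
Qed.

(** * Volume in three-space *)

Definition affine_form (R : realType) (g : 'cV[R]_3) (e : R) (x : R3 R) : R :=
  (x *m g) 0 0 + e.

(** The domain of [vec3] with its Borel product sigma-algebra; integrals over
    subsets of R^3 are pulled back to it. *)
Definition space3 (R : realType) :=
  (measurableTypeR R * measurableTypeR R * measurableTypeR R)%type.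

Definition lebesgue3 (R : realType) : {measure set (space3 R) -> \bar R} :=
  ((@lebesgue_measure R \x @lebesgue_measure R) \x @lebesgue_measure R)%E.

Lemma affine_formE (R : realType) (g : 'cV[R]_3) (e : R) (x : R3 R) :
  affine_form g e x = x 0 0 * g 0 0 + x 0 1 * g 1 0 + x 0 2 * g 2 0 + e.
Proof.
rewrite /affine_form mxE !big_ord_recl big_ord0 addr0 !addrA.
congr (_ + _ + _ + _); congr (x 0 _ * g _ 0); exact/val_inj.
Qed.

Lemma affine_form_vec3 (R : realType) (g : 'cV[R]_3) (e : R) (p : R * R * R) :
  affine_form g e (vec3 p) = p.1.1 * g 0 0 + p.1.2 * g 1 0 + p.2 * g 2 0 + e.
Proof. by rewrite affine_formE !mxE. Qed.

Lemma integral_onE (R : realType) (Omega : set (R3 R)) (f : R3 R -> R) :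
  integral_on Omega f =
  \int[lebesgue3 R]_(p in @vec3 R @^-1` Omega) f (vec3 p).
Proof. by []. Qed.

Lemma measurable_affine_form (R : realType) (g : 'cV[R]_3) (e : R)
  (D : set (space3 R)) :
  measurable_fun D (affine_form g e \o @vec3 R : space3 R -> R).
Proof.
rewrite (_ : _ \o _ =
  fun p : space3 R => p.1.1 * g 0 0 + p.1.2 * g 1 0 + p.2 * g 2 0 + e); last first.
  by apply/funext => p; exact: affine_form_vec3.
apply: measurable_funTS.
apply: measurable_funD => //; apply: measurable_funD; first apply: measurable_funD.
- apply: measurable_funM => //; exact: (measurableT_comp measurable_fst).
- apply: measurable_funM => //; exact: (measurableT_comp measurable_snd).
- by apply: measurable_funM => //; exact: measurable_snd.
Qed.

Lemma product_null_sections d1 d2 (T1 : measurableType d1)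
  (T2 : measurableType d2) (R : realType) (m1 : {measure set T1 -> \bar R})
  (m2 : {sigma_finite_measure set T2 -> \bar R}) (N : set (T1 * T2)) :
  (forall x, m2 (xsection N x) = 0%E) -> (m1 \x m2)%E N = 0%E.
Proof. by move=> N0; apply: integral0_eq => x _ /=; rewrite N0. Qed.

Lemma affine_zero_set (R : realType) (a b : R) :
  a != 0 -> [set x | x * a + b = 0] = [set - b / a].
Proof.
move=> a0; apply/seteqP; split => [x /= xab|x /= ->]; last by rewrite divfK// addNr.
by apply: (mulIf a0); rewrite divfK//; apply/eqP; rewrite -subr_eq0 opprK xab.
Qed.

Lemma lebesgue_affine_zero (R : realType) (a b : R) :
  a != 0 -> lebesgue_measure [set x | x * a + b = 0] = 0%E.
Proof. by move=> /affine_zero_set->; exact: lebesgue_measure_set1. Qed.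

(** By Fubini: along a coordinate with nonzero coefficient, every line meets the
    plane in one point.  The three cases are the three coordinates, tried from
    the outermost factor of the product measure inwards; once a coefficient
    vanishes, the set is a cylinder over a set of lower dimension. *)
Lemma lebesgue3_plane (R : realType) (g : 'cV[R]_3) (e : R) :
  g != 0 -> lebesgue3 R (@vec3 R @^-1` [set x | affine_form g e x = 0]) = 0%E.
Proof.
move=> g0.
rewrite (_ : _ @^-1` _ = [set p : space3 R |
    p.1.1 * g 0 0 + p.1.2 * g 1 0 + p.2 * g 2 0 + e = 0]); last first.
  by apply/seteqP; split => p /=; rewrite affine_form_vec3.
have [g2|g2] := eqVneq (g 2 0) 0; last first.
  apply: product_null_sections => -[x y].
  rewrite -[RHS](lebesgue_affine_zero (x * g 0 0 + y * g 1 0 + e) g2).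
  congr (lebesgue_measure _); apply/seteqP; split => z;
    by rewrite /xsection /= inE /= => <-; ring.
pose A := [set q : measurableTypeR R * measurableTypeR R |
  q.1 * g 0 0 + q.2 * g 1 0 + e = 0].
have mA : measurable A.
  pose f (q : measurableTypeR R * measurableTypeR R) : R :=
    q.1 * g 0 0 + q.2 * g 1 0 + e.
  have mf : measurable_fun setT f.
    apply: measurable_funD => //; apply: measurable_funD.
    - by apply: measurable_funM => //; exact: measurable_fst.
    - by apply: measurable_funM => //; exact: measurable_snd.
  by have := mf measurableT _ (measurable_set1 0); rewrite setTI.
rewrite (_ : [set p | _] = A `*` setT); last first.
  apply/seteqP; split => p /=; rewrite /A /= g2 mulr0 addr0 //.
  by case.
have -> : lebesgue3 R (A `*` setT) =
    ((@lebesgue_measure R \x @lebesgue_measure R) A * lebesgue_measure setT)%E.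
  exact: product_measure1E.
suff -> : (@lebesgue_measure R \x @lebesgue_measure R)%E A = 0%E by rewrite mul0e.
have [g1|g1] := eqVneq (g 1 0) 0; last first.
  apply: product_null_sections => x.
  rewrite -[RHS](lebesgue_affine_zero (x * g 0 0 + e) g1) /A.
  congr (lebesgue_measure _); apply/seteqP; split => z;
    by rewrite /xsection /= inE /= => <-; ring.
have g00 : g 0 0 != 0.
  apply: contra_neq g0 => g00; apply/colP => i; rewrite mxE.
  by case: i => -[|[|[|//]]] lti; [rewrite -g00|rewrite -g1|rewrite -g2];
    congr (g _ _); exact/val_inj.
rewrite (_ : A = [set x | x * g 0 0 + e = 0] `*` setT); last first.
  apply/seteqP; split => p /=; rewrite /A /= g1 mulr0 addr0 //.
  by case.
rewrite affine_zero_set// product_measure1E//.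
rewrite -[RHS](mul0e (@lebesgue_measure R setT)); congr (_ * _)%E.
exact: lebesgue_measure_set1.
Qed.

(** * Bounded measurable integrands *)

(** A class of integrands on [U] that is closed under sums and products, so that
    integrability of the polynomial expressions in Q and its derivatives below
    follows from that of their entries. *)
Definition bounded_measurable (R : realType) (U : set (R3 R))
  (f : R3 R -> R) : Prop :=
  measurable_fun (@vec3 R @^-1` U) (f \o @vec3 R : space3 R -> R) /\
  exists B, forall x, U x -> `|f x| <= B.

Lemma bounded_measurable_cst (R : realType) (U : set (R3 R)) (r : R) :
  bounded_measurable U (fun=> r).
Proof. by split; [exact: measurable_cst|exists `|r|]. Qed.

Lemma bounded_measurableD (R : realType) (U : set (R3 R)) (f g : R3 R -> R) :
  bounded_measurable U f -> bounded_measurable U g ->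
  bounded_measurable U (fun x => f x + g x).
Proof.
move=> [mf [B fB]] [mg [C gC]]; split; first exact: measurable_funD.
by exists (B + C) => x Ux; rewrite (le_trans (ler_normD _ _))// lerD// ?fB ?gC.
Qed.

Lemma bounded_measurableM (R : realType) (U : set (R3 R)) (f g : R3 R -> R) :
  bounded_measurable U f -> bounded_measurable U g ->
  bounded_measurable U (fun x => f x * g x).
Proof.
move=> [mf [B fB]] [mg [C gC]]; split; first exact: measurable_funM.
by exists (B * C) => x Ux; rewrite normrM ler_pM// ?fB ?gC.
Qed.

Lemma bounded_measurable_sum (R : realType) (U : set (R3 R)) (n : nat)
  (f : 'I_n -> R3 R -> R) :
  (forall i, bounded_measurable U (f i)) ->
  bounded_measurable U (fun x => \sum_i f i x).
Proof.
elim: n f => [|n IHn] f bf.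
  rewrite (_ : (fun _ => _) = fun=> 0); first exact: bounded_measurable_cst.
  by apply/funext => x; rewrite big_ord0.
rewrite (_ : (fun _ => _) =
    fun x => f ord0 x + \sum_(i < n) f (lift ord0 i) x).
  by apply: bounded_measurableD => //; exact: IHn.
by apply/funext => x; rewrite big_ord_recl.
Qed.

Lemma bounded_coord (R : realType) (U : set (R3 R)) :
  bounded_set U -> exists B, forall x, U x -> forall k, `|x 0 k| <= B.
Proof.
move=> /pinfty_ex_gt0 [B B0 UB]; exists B => x /UB xB k.
apply: le_trans xB; rewrite /Num.norm /= mx_normrE.
exact: (le_bigmax _ (fun ij : 'I_1 * 'I_3 => `|x ij.1 ij.2|) (0, k)).
Qed.

Lemma bounded_finite_volume (R : realType) (U : set (R3 R)) :
  measurable (@vec3 R @^-1` U : set (space3 R)) -> bounded_set U ->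
  (lebesgue3 R (@vec3 R @^-1` U) < +oo)%E.
Proof.
move=> mU /bounded_coord [B UB].
pose I : set (measurableTypeR R) := [set` `[- B, B]].
have mI : measurable I by exact: measurable_itv.
have mII : measurable (I `*` I `*` I).
  by do 2!apply: measurableX => //.
have II : lebesgue3 R (I `*` I `*` I) =
    (lebesgue_measure I * lebesgue_measure I * lebesgue_measure I)%E.
  transitivity
    ((lebesgue_measure \x lebesgue_measure) (I `*` I) * lebesgue_measure I)%E.
    by apply: product_measure1E => //; exact: measurableX.
  by congr (_ * _)%E; exact: product_measure1E.
have Ifin : (lebesgue_measure I < +oo)%E.
  by rewrite /I lebesgue_measure_itv /=; case: ifP; rewrite ?ltry.
apply: (@le_lt_trans _ _ (lebesgue3 R (I `*` I `*` I))).
  apply: le_measure; rewrite ?inE// => p /= /UB pB.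
  have := (pB 0, pB 1, pB 2); rewrite !mxE /= => -[[]].
  by rewrite !ler_norml /I /= !in_itv /=.
have I2 : (0 <= lebesgue_measure I * lebesgue_measure I)%E by exact: mule_ge0.
rewrite II lte_mul_pinfty// ge0_fin_numE//.
by rewrite lte_mul_pinfty// ge0_fin_numE.
Qed.

Lemma bounded_measurable_integrable (R : realType) (U : set (R3 R)) (f : R3 R -> R) :
  measurable (@vec3 R @^-1` U : set (space3 R)) -> bounded_set U ->
  bounded_measurable U f ->
  (lebesgue3 R).-integrable (@vec3 R @^-1` U) (EFin \o (f \o @vec3 R)).
Proof.
move=> mU bU [mf [B fB]].
apply: measurable_bounded_integrable => //; first exact: bounded_finite_volume.
exists B; split; first exact: num_real.
by move=> C BC p /= /fB fpB; apply: le_trans fpB (ltW BC).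
Qed.

Lemma bounded_measurable_affine_form (R : realType) (U : set (R3 R))
  (g : 'cV[R]_3) (e : R) :
  bounded_set U -> bounded_measurable U (affine_form g e).
Proof.
move=> /bounded_coord [B UB]; split; first exact: measurable_affine_form.
exists (B * (\sum_k `|g k 0|) + `|e|) => x Ux.
rewrite (le_trans (ler_normD _ _))// lerD2r mxE mulr_sumr.
rewrite (le_trans (ler_norm_sum _ _ _))// ler_sum// => k _.
by rewrite normrM ler_wpM2r// UB.
Qed.

Lemma eq_bounded_measurable (R : realType) (U : set (R3 R)) (f g : R3 R -> R) :
  (forall x, U x -> f x = g x) -> bounded_measurable U f -> bounded_measurable U g.
Proof.
move=> fg [mf [B fB]]; split.
  by apply: eq_measurable_fun mf => p; rewrite inE => /= /fg.
by exists B => x Ux; rewrite -fg// fB.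
Qed.

Lemma bounded_measurable_bigcup (R : realType) (L : nat) (U : 'I_L -> set (R3 R))
  (f : R3 R -> R) :
  (forall l, measurable (@vec3 R @^-1` U l : set (space3 R))) ->
  (forall l, bounded_measurable (U l) f) ->
  bounded_measurable (\bigcup_l U l) f.
Proof.
move=> mU bf; split.
  move=> _ Y mY; rewrite preimage_bigcup setI_bigcupl.
  apply: fin_bigcup_measurable => [|l _]; first exact: finite_finset.
  by have [mf _] := bf l; exact: (mf (mU l) _ mY).
have /choice [B fB] : forall l, exists B, forall x, U l x -> `|f x| <= B.
  by move=> l; have [_ ?] := bf l.
exists (\sum_l `|B l|) => x [l _ /fB fx].
apply: (le_trans fx); apply: (le_trans (ler_norm _)).
by rewrite (bigD1 l)//= lerDl sumr_ge0.
Qed.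

Section IntegralOn.
Variables (R : realType) (U : set (R3 R)).
Hypothesis mU : measurable (@vec3 R @^-1` U : set (space3 R)).
Hypothesis bU : bounded_set U.

Lemma integral_onD f g : bounded_measurable U f -> bounded_measurable U g ->
  integral_on U (fun x => f x + g x) = integral_on U f + integral_on U g.
Proof.
move=> bf bg; rewrite !integral_onE.
by apply: RintegralD => //; exact: bounded_measurable_integrable.
Qed.

Lemma integral_onZ k f : bounded_measurable U f ->
  integral_on U (fun x => k * f x) = k * integral_on U f.
Proof.
move=> bf; rewrite !integral_onE.
by apply: RintegralZl => //; exact: bounded_measurable_integrable.
Qed.

Lemma eq_integral_on f g : (forall x, U x -> f x = g x) ->
  integral_on U f = integral_on U g.
Proof.
move=> fg; rewrite !integral_onE; apply: eq_Rintegral => p; rewrite inE => /= Up.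
exact: fg.
Qed.
End IntegralOn.

(** * Barycentric coordinates and open simplices *)

Definition barycentric_coords (R : realType) (p : 'I_4 -> R3 R)
  (g : 'I_4 -> 'cV[R]_3) (e : 'I_4 -> R) : Prop :=
  [/\ forall x, \sum_i affine_form (g i) (e i) x = 1,
      forall x, \sum_i affine_form (g i) (e i) x *: p i = x &
      forall w, \sum_i w i = 1 -> forall i,
        affine_form (g i) (e i) (\sum_i w i *: p i) = w i].

(** The coordinates of the vertices other than p_0 are read off from x - p_0
    through the inverse of the edge matrix; that of p_0 is one minus their sum. *)
Lemma barycentric_coords_exist (R : realType) (p : 'I_4 -> R3 R) :
  \det (\matrix_(i < 3) (p (lift ord0 i) - p ord0)) != 0 ->
  exists g e, barycentric_coords p g e.
Proof.
set E := \matrix_(i < 3) _ => dE.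
have uE : E \in unitmx by rewrite unitmxE unitfE.
pose h j := col j (invmx E).
pose k j := - (p ord0 *m h j) 0 0.
pose g i := if unlift ord0 i is Some j then h j else - \sum_j h j.
pose e i := if unlift ord0 i is Some j then k j else 1 - \sum_j k j.
have colE (y : R3 R) j : (y *m h j) 0 0 = (y *m invmx E) 0 j.
  by rewrite !mxE; apply: eq_bigr => i _; rewrite mxE.
have formS j x : affine_form (g (lift ord0 j)) (e (lift ord0 j)) x =
    ((x - p ord0) *m invmx E) 0 j.
  by rewrite /affine_form /g /e liftK /k !colE mulmxBl !mxE.
have form0 x : affine_form (g ord0) (e ord0) x =
    1 - \sum_j affine_form (g (lift ord0 j)) (e (lift ord0 j)) x.
  rewrite {1}/affine_form /g /e unlift_none.
  under [in RHS]eq_bigr do rewrite liftK /affine_form.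
  rewrite big_split /= mulmxN mulmx_sumr mxE summxE; ring.
have bE w : \sum_i w i = 1 ->
    (\sum_i w i *: p i) - p ord0 = (\row_j w (lift ord0 j)) *m E.
  move=> w1; rewrite mulmx_sum_row big_ord_recl /=.
  under [in RHS]eq_bigr do rewrite rowK mxE scalerBr.
  rewrite sumrB -scaler_suml.
  have -> : \sum_i w (lift ord0 i) = 1 - w ord0.
    by rewrite -w1 [in RHS]big_ord_recl addrAC subrr add0r.
  by rewrite scalerBl scale1r opprB [in RHS]addrCA addrA.
have S1 x : \sum_i affine_form (g i) (e i) x = 1.
  by rewrite big_ord_recl form0 subrK.
exists g, e; split => // [x|w w1 i].
  apply: (addIr (- p ord0)); rewrite bE//.
  rewrite -[RHS](mulmxKV uE); congr (_ *m E).
  by apply/rowP => j; rewrite mxE formS.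
have formw j :
    affine_form (g (lift ord0 j)) (e (lift ord0 j)) (\sum_i w i *: p i) =
    w (lift ord0 j).
  by rewrite formS bE// mulmxK// mxE.
have [j|] := unliftP ord0 i => ->; first exact: formw.
rewrite form0; under eq_bigr do rewrite formw.
by rewrite -w1 [X in X - _ = _]big_ord_recl addrK.
Qed.

Lemma continuous_affine_form (R : realType) (g : 'cV[R]_3) (e : R) :
  continuous (affine_form g e).
Proof.
rewrite (_ : affine_form g e =
   (fun x => x 0 0 * g 0 0 + x 0 1 * g 1 0 + x 0 2 * g 2 0 + e)); last first.
  by apply/funext => x; rewrite affine_formE.
have ck k : continuous (fun x : R3 R => x 0 k * g k 0).
  by move=> x; apply: (@cvgMl R (R3 R) (nbhs x)); exact: coord_continuous.
move=> x; apply: (@cvgD R R (R3 R) (nbhs x)); last exact: (cvg_cst e).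
apply: (@cvgD R R (R3 R) (nbhs x)); last exact: ck.
apply: (@cvgD R R (R3 R) (nbhs x)); exact: ck.
Qed.

Definition open_simplex (R : realType) (p : 'I_4 -> R3 R) : set (R3 R) :=
  [set x | exists w : 'I_4 -> R, [/\ forall i, 0 < w i, \sum_i w i = 1 &
     x = \sum_i w i *: p i]].

Lemma open_simplex_tetrahedron (R : realType) (p : 'I_4 -> R3 R) :
  open_simplex p `<=` tetrahedron p.
Proof.
move=> x [w [w0 w1 ->]]; exists w; split => // i; first exact: ltW.
by rewrite finset.in_setT.
Qed.

Lemma open_simplexE (R : realType) (p : 'I_4 -> R3 R) g e :
  barycentric_coords p g e ->
  open_simplex p = \bigcap_i (affine_form (g i) (e i) @^-1` [set r | 0 < r]).
Proof.
move=> [b1 bp bw]; apply/seteqP; split => [x [w [w0 w1 ->]] i _ /=|x xp].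
  by rewrite bw.
exists (fun i => affine_form (g i) (e i) x); split => // i; exact: xp.
Qed.

Lemma open_open_simplex (R : realType) (p : 'I_4 -> R3 R) :
  \det (\matrix_(i < 3) (p (lift ord0 i) - p ord0)) != 0 ->
  open (open_simplex p).
Proof.
move=> /barycentric_coords_exist [g [e /open_simplexE ->]].
rewrite -[X in open X]setCK.
apply: closed_openC; rewrite setC_bigcap.
apply: closed_bigcup => [|i _]; first exact: finite_finset.
apply: open_closedC; apply: open_comp; last exact: open_gt.
by move=> x _; exact: continuous_affine_form.
Qed.

Lemma measurable_open_simplex (R : realType) (p : 'I_4 -> R3 R) :
  \det (\matrix_(i < 3) (p (lift ord0 i) - p ord0)) != 0 ->
  measurable (@vec3 R @^-1` open_simplex p : set (space3 R)).
Proof.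
move=> /barycentric_coords_exist [g [e /open_simplexE ->]].
rewrite preimage_bigcap; apply: fin_bigcap_measurable => [|i _].
  exact: finite_finset.
have := @measurable_affine_form R (g i) (e i) setT measurableT.
move=> /(_ [set r | 0 < r]); rewrite setTI; apply.
by rewrite -set_itvoy; exact: measurable_itv.
Qed.

Lemma fin_bigcup_null d (T : measurableType d) (R : realType)
  (mu : {measure set T -> \bar R}) (I : finType) (F : I -> set T) :
  (forall i, measurable (F i)) -> (forall i, mu (F i) = 0%E) ->
  mu (\bigcup_i F i) = 0%E.
Proof.
move=> mF F0; have fI : finite_set [set: I] by exact: finite_finset.
apply/eqP; rewrite eq_le measure_ge0 andbT.
have -> : 0%E = (\sum_(i \in [set: I]) mu (F i))%E by rewrite fsbig1.
by apply: content_sub_fsum => //; exact: fin_bigcup_measurable.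
Qed.

(** A point of the closed simplex outside the open one has a vanishing barycentric
    coordinate, hence lies in one of four planes.  The coordinate forms have
    nonzero gradient, since each takes the value 1 at its own vertex and 0 at
    the others. *)
Lemma tetrahedron_boundary_null (R : realType) (p : 'I_4 -> R3 R) :
  \det (\matrix_(i < 3) (p (lift ord0 i) - p ord0)) != 0 ->
  exists N : set (space3 R), [/\ measurable N, lebesgue3 R N = 0%E &
    @vec3 R @^-1` tetrahedron p `<=` @vec3 R @^-1` open_simplex p `|` N].
Proof.
move=> /barycentric_coords_exist [g [e be]].
have [b1 bp bw] := be.
pose F i : set (space3 R) :=
  @vec3 R @^-1` [set x | affine_form (g i) (e i) x = 0].
have mF i : measurable (F i).
  have := @measurable_affine_form R (g i) (e i) setT measurableT.
  by move=> /(_ _ (measurable_set1 0)); rewrite setTI.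
have g0 i : g i != 0.
  apply/eqP => gi0.
  (* A vertex is the combination of the vertices with weights (k == j). *)
  have vertex j : affine_form (g i) (e i) (p j) = (i == j)%:R.
    rewrite -(bw (fun k => (k == j)%:R)).
      congr affine_form; rewrite (bigD1 j)//= eqxx scale1r big1 ?addr0//.
      by move=> k /negPf->; rewrite scale0r.
    by rewrite (bigD1 j)//= eqxx big1 ?addr0// => k /negPf->.
  have := vertex i; have := vertex (lift i ord0).
  rewrite /affine_form gi0 !mulmx0 eqxx (negPf (neq_lift _ _)) => ->.
  by move/eqP; rewrite eq_sym oner_eq0.
exists (\bigcup_i F i); split.
- by apply: fin_bigcup_measurable => // i _; exact: mF.
- by apply: fin_bigcup_null => // i; exact: lebesgue3_plane.
- move=> q [w [w0 _ w1 qw]].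
  have [wpos|/existsNP[i]] := pselect (forall i, 0 < w i).
    by left; exists w.
  move/negP; rewrite -leNgt => wi; right; exists i => //=.
  by rewrite /F /= qw bw//; apply/eqP; rewrite eq_le wi w0.
Qed.

(** * Derivatives of piecewise affine fields *)

(** The difference quotients of an affine field are constant, and near a point of
    the open simplex the field is affine, so the limit exists and is the
    corresponding entry of the linear part.  Linearity of the derivatives of
    finite element fields is derived from this formula. *)
Lemma partial_affine (R : realType) (p : 'I_4 -> R3 R) (A : mxfield R)
  (u : {linear R3 R -> 'M[R]_3}) (d : 'M[R]_3) (x : R3 R) (k i j : 'I_3) :
  \det (\matrix_(i < 3) (p (lift ord0 i) - p ord0)) != 0 ->
  (forall y, tetrahedron p y -> A y = u y + d) -> open_simplex p x ->
  partial k (fun y => A y i j) x = u (delta_mx 0 k) i j.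
Proof.
move=> dp Au px; rewrite /partial.
rewrite (@near_eq_derive _ _ _ _ (fun y => u y i j + d i j)); last first.
  have := open_nbhs_nbhs (conj (open_open_simplex dp) px).
  apply: filterS => y /open_simplex_tetrahedron py.
  by rewrite Au// mxE.
apply: lim_near_cst => //; near=> h.
have h0 : h != 0 by near: h; exact: nbhs_dnbhs_neq.
rewrite /=; have -> : u (h *: delta_mx 0 k + x) = h *: u (delta_mx 0 k) + u x.
  exact: linearP.
by rewrite !mxE opprD addrACA subrr addr0 addrK /GRing.scale /= mulKf.
Unshelve. all: by end_near. Qed.

Lemma affine_on_lincomb (R : realType) (T : set (R3 R)) (A B : mxfield R)
  (a b : R) :
  affine_on T A -> affine_on T B -> affine_on T (fun y => a *: A y + b *: B y).
Proof.
move=> [u [d Au]] [w [f Bw]].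
exists ((a \*: u) \+ (b \*: w)), (a *: d + b *: f) => x Tx.
by rewrite Au// Bw// !scalerDr addrACA.
Qed.

Lemma grad_lincomb (R : realType) (p : 'I_4 -> R3 R) (A B : mxfield R)
  (a b : R) x :
  \det (\matrix_(i < 3) (p (lift ord0 i) - p ord0)) != 0 ->
  affine_on (tetrahedron p) A -> affine_on (tetrahedron p) B ->
  open_simplex p x ->
  grad (fun y => a *: A y + b *: B y) x = a *: grad A x + b *: grad B x.
Proof.
move=> dp [u [d Au]] [w [f Bw]] px; apply/ffunP => k; rewrite !ffunE.
apply/matrixP => i j; rewrite !mxE.
rewrite (partial_affine k i j dp Au px) (partial_affine k i j dp Bw px).
rewrite (@partial_affine _ p _ ((a \*: u) \+ (b \*: w)) (a *: d + b *: f)) //.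
  by rewrite /= !mxE.
by move=> y py; rewrite Au// Bw// !scalerDr addrACA.
Qed.

Lemma div_mx_grad (R : realType) (A : mxfield R) (x : R3 R) :
  div_mx A x = \col_j \sum_k grad A x k j k.
Proof.
apply/colP => j; rewrite !mxE; apply: eq_bigr => k _; rewrite ffunE mxE.
by congr (partial k _ x); apply/funext => y; rewrite mxE.
Qed.

Lemma curl_mx_grad (R : realType) (A : mxfield R) (x : R3 R) :
  curl_mx A x =
  \matrix_(i, j) (grad A x (i + 1) j (i + 2) - grad A x (i + 2) j (i + 1)).
Proof.
apply/matrixP => i j; rewrite !mxE !ffunE !mxE.
by congr (partial _ _ x - partial _ _ x); apply/funext => y; rewrite mxE.
Qed.

Lemma div_mx_lincomb (R : realType) (A B C : mxfield R) (a b : R) x :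
  grad C x = a *: grad A x + b *: grad B x ->
  div_mx C x = a *: div_mx A x + b *: div_mx B x.
Proof.
rewrite !div_mx_grad => ->; apply/colP => j; rewrite !mxE !mulr_sumr -big_split.
by apply: eq_bigr => k _; rewrite !ffunE !mxE.
Qed.

Lemma curl_mx_lincomb (R : realType) (A B C : mxfield R) (a b : R) x :
  grad C x = a *: grad A x + b *: grad B x ->
  curl_mx C x = a *: curl_mx A x + b *: curl_mx B x.
Proof.
rewrite !curl_mx_grad => ->; apply/matrixP => i j; rewrite !(ffunE, mxE) /=.
ring.
Qed.

(** * Bounded measurable matrix fields *)

Definition bounded_measurable_mx (R : realType) (U : set (R3 R)) (m n : nat)
  (A : R3 R -> 'M[R]_(m, n)) : Prop :=
  forall i j, bounded_measurable U (fun x => A x i j).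

Section BoundedMeasurableMatrix.
Variables (R : realType) (U : set (R3 R)).

Lemma bounded_measurable_mxD m n (A B : R3 R -> 'M[R]_(m, n)) :
  bounded_measurable_mx U A -> bounded_measurable_mx U B ->
  bounded_measurable_mx U (fun x => A x + B x).
Proof.
move=> bA bB i j.
apply: eq_bounded_measurable (bounded_measurableD (bA i j) (bB i j)).
by move=> x _; rewrite mxE.
Qed.

Lemma bounded_measurable_mxZ m n (f : R3 R -> R) (A : R3 R -> 'M[R]_(m, n)) :
  bounded_measurable U f -> bounded_measurable_mx U A ->
  bounded_measurable_mx U (fun x => f x *: A x).
Proof.
move=> bf bA i j.
apply: eq_bounded_measurable (bounded_measurableM bf (bA i j)).
by move=> x _; rewrite mxE.
Qed.

Lemma bounded_measurable_mx_cst m n (A : 'M[R]_(m, n)) :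
  bounded_measurable_mx U (fun=> A).
Proof. by move=> i j; exact: bounded_measurable_cst. Qed.

Lemma bounded_measurable_mxM m n q (A : R3 R -> 'M[R]_(m, n))
  (B : R3 R -> 'M[R]_(n, q)) :
  bounded_measurable_mx U A -> bounded_measurable_mx U B ->
  bounded_measurable_mx U (fun x => A x *m B x).
Proof.
move=> bA bB i j.
apply: (@eq_bounded_measurable _ _ (fun x => \sum_k A x i k * B x k j)).
  by move=> x _; rewrite mxE.
by apply: bounded_measurable_sum => k; exact: bounded_measurableM.
Qed.

Lemma bounded_measurable_frob m n (A B : R3 R -> 'M[R]_(m, n)) :
  bounded_measurable_mx U A -> bounded_measurable_mx U B ->
  bounded_measurable U (fun x => frob (A x) (B x)).
Proof.
move=> bA bB; apply: bounded_measurable_sum => i.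
by apply: bounded_measurable_sum => j; exact: bounded_measurableM.
Qed.

Lemma bounded_measurable_tr n (A : R3 R -> 'M[R]_n) :
  bounded_measurable_mx U A -> bounded_measurable U (fun x => \tr (A x)).
Proof. by move=> bA; exact: bounded_measurable_sum. Qed.

Lemma bounded_measurable_mxX n (A : R3 R -> 'M[R]_n.+1) k :
  bounded_measurable_mx U A -> bounded_measurable_mx U (fun x => A x ^+ k).
Proof.
move=> bA; elim: k => [|k IHk]; first exact: bounded_measurable_mx_cst.
rewrite (_ : (fun _ => _) = fun x => A x *m A x ^+ k).
  exact: bounded_measurable_mxM.
by apply/funext => x; rewrite exprS.
Qed.

Lemma bounded_measurable_fnorm_sqr m n (A : R3 R -> 'M[R]_(m, n)) :
  bounded_measurable_mx U A -> bounded_measurable U (fun x => fnorm (A x) ^+ 2).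
Proof.
move=> bA; apply: eq_bounded_measurable (bounded_measurable_frob bA bA) => x _.
by rewrite fnorm_sqr.
Qed.

Lemma bounded_measurable_div (A : mxfield R) :
  (forall k, bounded_measurable_mx U (fun x => grad A x k)) ->
  bounded_measurable_mx U (div_mx A).
Proof.
move=> bA i j; apply: (@eq_bounded_measurable _ _ (fun x => \sum_k grad A x k i k)).
  by move=> x _; rewrite div_mx_grad mxE.
by apply: bounded_measurable_sum => k; exact: bA.
Qed.

Lemma bounded_measurable_curl (A : mxfield R) :
  (forall k, bounded_measurable_mx U (fun x => grad A x k)) ->
  bounded_measurable_mx U (curl_mx A).
Proof.
move=> bA i j; apply: (@eq_bounded_measurable _ _
  (fun x => grad A x (i + 1) j (i + 2) + -1 * grad A x (i + 2) j (i + 1))).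
  by move=> x _; rewrite curl_mx_grad mxE mulN1r.
apply: bounded_measurableD; first exact: bA.
apply: bounded_measurableM; [exact: bounded_measurable_cst|exact: bA].
Qed.

Lemma bounded_measurable_tdot (T V : R3 R -> tensor R) :
  (forall k, bounded_measurable_mx U (fun x => T x k)) ->
  (forall k, bounded_measurable_mx U (fun x => V x k)) ->
  bounded_measurable U (fun x => tdot (T x) (V x)).
Proof.
move=> bT bV; apply: bounded_measurable_sum => k.
exact: bounded_measurable_frob.
Qed.

Lemma bounded_measurable_tnorm_sqr (T : R3 R -> tensor R) :
  (forall k, bounded_measurable_mx U (fun x => T x k)) ->
  bounded_measurable U (fun x => tnorm (T x) ^+ 2).
Proof.
move=> bT; apply: eq_bounded_measurable (bounded_measurable_tdot bT bT) => x _.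
by rewrite tnorm_sqr.
Qed.

Lemma bounded_measurable_bulk a b c (A : mxfield R) :
  bounded_measurable_mx U A -> bounded_measurable U (fun x => bulk a b c (A x)).
Proof.
move=> bA; have bt m : bounded_measurable U (fun x => \tr (A x ^+ m)).
  by apply: bounded_measurable_tr; exact: bounded_measurable_mxX.
apply: (@eq_bounded_measurable _ _ (fun x => a * \tr (A x ^+ 2)
  + (- (2 * b / 3)) * \tr (A x ^+ 3)
  + (c / 2) * (\tr (A x ^+ 2) * \tr (A x ^+ 2)))).
  by move=> x _; rewrite /bulk mulNr expr2.
have bZ k f : bounded_measurable U f -> bounded_measurable U (fun x => k * f x).
  by apply: bounded_measurableM; exact: bounded_measurable_cst.
apply: bounded_measurableD; first apply: bounded_measurableD.
- exact: bZ.
- exact: bZ.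
- by apply: bZ; exact: bounded_measurableM.
Qed.

End BoundedMeasurableMatrix.

(** * The union of the element interiors *)

Lemma linear_entry (R : realType) (u : {linear R3 R -> 'M[R]_3}) (d : R)
  (x : R3 R) (i j : 'I_3) :
  u x i j + d = affine_form (\col_k u (delta_mx 0 k) i j) d x.
Proof.
rewrite {1}(row_sum_delta x) linear_sum summxE /affine_form mxE; congr (_ + _).
by apply: eq_bigr => k _; rewrite linearZ !mxE.
Qed.

Definition element_interiors (R : realType) (L : nat) (v : 'I_L -> 'I_4 -> R3 R)
  : set (R3 R) :=
  \bigcup_l open_simplex (v l).

Section ElementInteriors.
Variables (R : realType) (Omega : set (R3 R)).
Variables (L : nat) (v : 'I_L -> 'I_4 -> R3 R).
Hypothesis hv : triangulation Omega v.
Hypothesis hO : bounded_set Omega.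
Let U := element_interiors v.

Lemma element_interiors_sub : U `<=` Omega.
Proof.
move=> x [l _ xl]; apply: (tri_interior hv (l := l)).
have ol := open_open_simplex (tri_nondegenerate hv l).
by apply: filterS (open_nbhs_nbhs (conj ol xl)); exact: open_simplex_tetrahedron.
Qed.

Lemma measurable_element_interiors : measurable (@vec3 R @^-1` U : set (space3 R)).
Proof.
rewrite preimage_bigcup; apply: fin_bigcup_measurable => [|l _].
  exact: finite_finset.
by apply: measurable_open_simplex; exact: tri_nondegenerate hv _.
Qed.

Lemma bounded_element_interiors : bounded_set U.
Proof.
have /pinfty_ex_gt0 [B B0 OB] := hO.
exists B; split; first exact: num_real.
by move=> C BC x /element_interiors_sub/OB xB; apply: le_trans xB (ltW BC).
Qed.

(** Omega is covered by the closed elements, whose boundaries are null.  All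
    integrals are moved to the element interiors, where finite element fields
    are smooth. *)
Lemma integral_on_element_interiors (f : R3 R -> R) :
  integral_on Omega f = integral_on U f.
Proof.
have /choice [N hN] := fun l => tetrahedron_boundary_null (tri_nondegenerate hv l).
rewrite !integral_onE; congr fine.
apply: (@integral_ignore_null _ _ _ _ (\bigcup_l N l)).
- by apply: fin_bigcup_measurable => [|l _]; [exact: finite_finset|case: (hN l)].
- by apply: fin_bigcup_null => l; case: (hN l).
- by move=> p; exact: element_interiors_sub.
- move=> p /= /subset_closure; rewrite (tri_cover hv) => -[l _ pl].
  have [_ _ /(_ p pl) [pU|pN]] := hN l; last by right; exists l.
  by left; exists l.
Qed.

Lemma bounded_measurable_affine (A : mxfield R) :
  (forall l, affine_on (tetrahedron (v l)) A) -> bounded_measurable_mx U A.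
Proof.
move=> affA i j; apply: bounded_measurable_bigcup => l.
  exact: measurable_open_simplex (tri_nondegenerate hv l).
have [u [d Au]] := affA l.
apply: eq_bounded_measurable (bounded_measurable_affine_form
  (\col_k u (delta_mx 0 k) i j) (d i j) _) => [x xl|].
  by rewrite Au ?mxE ?linear_entry//; exact: open_simplex_tetrahedron.
have [B [rB UB]] := bounded_element_interiors.
by exists B; split => // C BC x xl; apply: UB => //; exists l.
Qed.

Lemma bounded_measurable_grad (A : mxfield R) :
  (forall l, affine_on (tetrahedron (v l)) A) ->
  forall k, bounded_measurable_mx U (fun x => grad A x k).
Proof.
move=> affA k i j; apply: bounded_measurable_bigcup => l.
  exact: measurable_open_simplex (tri_nondegenerate hv l).
have [u [d Au]] := affA l.
apply: eq_bounded_measurable (bounded_measurable_cst _ (u (delta_mx 0 k) i j)).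
move=> x xl; rewrite ffunE mxE.
by rewrite (partial_affine k i j (tri_nondegenerate hv l) Au xl).
Qed.

End ElementInteriors.

(** * Finite element spaces *)

Lemma within_continuous_lincomb (R : realType) (D : set (R3 R))
  (A B : mxfield R) (a b : R) :
  {within D, continuous A} -> {within D, continuous B} ->
  {within D, continuous (fun x => a *: A x + b *: B x)}.
Proof.
move=> cA cB x; apply: (@cvgD R 'M[R]_3 _ (nbhs x)).
  by apply: (@cvgZr R 'M[R]_3 _ (nbhs x)); exact: cA.
by apply: (@cvgZr R 'M[R]_3 _ (nbhs x)); exact: cB.
Qed.

Lemma T0_lincomb (R : realType) (Omega : set (R3 R)) (L : nat)
  (v : 'I_L -> 'I_4 -> R3 R) (A B : mxfield R) (a b : R) :
  T0 Omega v A -> T0 Omega v B -> T0 Omega v (fun x => a *: A x + b *: B x).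
Proof.
move=> [[cA sA affA] A0] [[cB sB affB] B0]; split; last first.
  by move=> x bx; rewrite A0// B0// !scaler0 addr0.
split => [|x /[dup] /sA [stA trA] /sB [stB trB]|l].
- exact: within_continuous_lincomb.
- split; first by rewrite linearD /= !linearZ /= stA stB.
  by rewrite mxtraceD !mxtraceZ trA trB !mulr0 addr0.
- exact: affine_on_lincomb.
Qed.

(** Successive iterates share the boundary lift, which cancels: this makes the
    difference quotient an admissible test function. *)
Lemma TG_difference_quotient (R : realType) (Omega : set (R3 R)) (L : nat)
  (v : 'I_L -> 'I_4 -> R3 R) (Gh : mxfield R) (dt : R) (Q : nat -> mxfield R)
  (n : nat) :
  TG Omega v Gh (Q n) -> TG Omega v Gh (Q n.+1) ->
  T0 Omega v (difference_quotient dt Q n).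
Proof.
move=> [A TA QA] [B TB QB].
rewrite (_ : difference_quotient dt Q n =
  fun x => dt^-1 *: B x + (- dt^-1) *: A x); first exact: T0_lincomb.
apply/funext => x; rewrite /difference_quotient -QA -QB /=.
by rewrite opprD addrACA subrr addr0 scalerBr scaleNr.
Qed.

(** * Exact increment of the energy *)

Section EnergyIncrement.
Variables (R : realType) (Omega : set (R3 R)).
Variables (L : nat) (v : 'I_L -> 'I_4 -> R3 R).
Hypothesis hv : triangulation Omega v.
Hypothesis hO : bounded_set Omega.
Variable Q : nat -> mxfield R.
Hypothesis affQ : forall m l, affine_on (tetrahedron (v l)) (Q m).
Hypothesis symQ : forall m x, Omega x -> (Q m x)^T = Q m x.
Variables (dt : R) (n : nat).
Let U := element_interiors v.
Let phi := difference_quotient dt Q n.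

Let mU := measurable_element_interiors hv.
Let bU := bounded_element_interiors hv hO.
Let bQ m := bounded_measurable_affine hv hO (affQ m).
Let bgQ m := bounded_measurable_grad hv (affQ m).

Lemma midpoint_lincomb :
  midpoint Q n = fun y => 2^-1 *: Q n.+1 y + 2^-1 *: Q n y.
Proof. by apply/funext => y; rewrite /midpoint scalerDr. Qed.

Lemma phi_lincomb : phi = fun y => dt^-1 *: Q n.+1 y + (- dt^-1) *: Q n y.
Proof.
by apply/funext => y; rewrite /phi /difference_quotient scalerBr scaleNr.
Qed.

Lemma affine_on_midpoint l : affine_on (tetrahedron (v l)) (midpoint Q n).
Proof. by rewrite midpoint_lincomb; exact: affine_on_lincomb. Qed.

Lemma affine_on_phi l : affine_on (tetrahedron (v l)) phi.
Proof. by rewrite phi_lincomb; exact: affine_on_lincomb. Qed.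

Lemma grad_midpoint x : U x ->
  grad (midpoint Q n) x = 2^-1 *: grad (Q n.+1) x + 2^-1 *: grad (Q n) x.
Proof.
move=> [l _ xl]; rewrite midpoint_lincomb.
exact: (grad_lincomb _ _ (tri_nondegenerate hv l)).
Qed.

Lemma grad_phi x : U x ->
  grad phi x = dt^-1 *: grad (Q n.+1) x + (- dt^-1) *: grad (Q n) x.
Proof.
move=> [l _ xl]; rewrite phi_lincomb.
exact: (grad_lincomb _ _ (tri_nondegenerate hv l)).
Qed.

Lemma integral_increment k f' f g :
  bounded_measurable U f' -> bounded_measurable U f ->
  (forall x, U x -> g x = k * (f' x - f x)) ->
  integral_on Omega g = k * (integral_on Omega f' - integral_on Omega f).
Proof.
move=> bf' bf gE; rewrite !(integral_on_element_interiors hv) -/U.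
have bN : bounded_measurable U (fun x => -1 * f x).
  by apply: bounded_measurableM => //; exact: bounded_measurable_cst.
rewrite (eq_integral_on (g := fun x => k * (f' x + -1 * f x))); last first.
  by move=> x Ux; rewrite gE// mulN1r.
rewrite integral_onZ//; last exact: bounded_measurableD.
by rewrite integral_onD// integral_onZ// mulN1r.
Qed.

(** Covers the four terms with divergence and curl at once: [op] is either
    operator, [S] either coefficient matrix, and [eps] the sign with which Q
    occurs in [S], which explains the sign in front of the last product of the
    corresponding term of the scheme. *)
Lemma weighted_increment q (op : mxfield R -> R3 R -> 'M[R]_(3, q))
  (S : 'M[R]_3 -> 'M[R]_3) (eps : R) :
  (forall A B, S A - S B = eps *: (A - B)) ->
  (forall A B C a b x, grad C x = a *: grad A x + b *: grad B x ->
     op C x = a *: op A x + b *: op B x) ->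
  (forall m, bounded_measurable_mx U (fun x => S (Q m x))) ->
  (forall m, bounded_measurable_mx U (op (Q m))) ->
  inner Omega (midpoint (fun m x => S (Q m x) *m op (Q m) x) n)
    (fun x => midpoint (fun m y => S (Q m y)) n x *m op phi x +
              eps *: (phi x *m op (midpoint Q n) x)) =
  dt^-1 / 2 *
   (integral_on Omega (fun x => fnorm (S (Q n.+1 x) *m op (Q n.+1) x) ^+ 2) -
    integral_on Omega (fun x => fnorm (S (Q n x) *m op (Q n) x) ^+ 2)).
Proof.
move=> S_diff op_lin bS bop.
have bf m : bounded_measurable U (fun x => fnorm (S (Q m x) *m op (Q m) x) ^+ 2).
  by apply: bounded_measurable_fnorm_sqr; exact: bounded_measurable_mxM.
apply: integral_increment => // x Ux.
rewrite (op_lin _ _ _ _ _ _ (grad_phi Ux)).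
rewrite (op_lin _ _ _ _ _ _ (grad_midpoint Ux)).
rewrite /midpoint scaleNr -scalerBr -scalerDr scalemxAl /phi /difference_quotient.
(* Move the sign next to the increment of Q, making it an increment of S. *)
rewrite scalerA mulrC -scalerA -S_diff.
exact: weighted_square_increment.
Qed.

Lemma bounded_measurable_S1 s0 m :
  bounded_measurable_mx U (fun x => S1 s0 (Q m x)).
Proof.
apply: bounded_measurable_mxD; first exact: bounded_measurable_mx_cst.
exact: bQ.
Qed.

Lemma bounded_measurable_S2 s0 m :
  bounded_measurable_mx U (fun x => S2 s0 (Q m x)).
Proof.
rewrite (_ : (fun _ => _) = fun x => (2 * s0 / 3) *: 1%:M + -1 *: Q m x).
  apply: bounded_measurable_mxD; first exact: bounded_measurable_mx_cst.
  apply: (bounded_measurable_mxZ (bounded_measurable_cst _ _)).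
  exact: bQ.
by apply/funext => x; rewrite scaleN1r.
Qed.

Lemma S1_diff s0 (A B : 'M[R]_3) : S1 s0 A - S1 s0 B = 1 *: (A - B).
Proof. by rewrite /S1 scale1r opprD addrACA subrr add0r. Qed.

Lemma S2_diff s0 (A B : 'M[R]_3) : S2 s0 A - S2 s0 B = -1 *: (A - B).
Proof. by rewrite /S2 scaleN1r opprD opprK addrACA subrr add0r opprB addrC. Qed.

Lemma H1_increment L1 s0 : H1 Omega L1 s0 Q n phi =
  L1 * (dt^-1 / 2 *
   (integral_on Omega (fun x =>
          fnorm (S1 s0 (Q n.+1 x) *m div_mx (Q n.+1) x) ^+ 2) -
    integral_on Omega (fun x => fnorm (S1 s0 (Q n x) *m div_mx (Q n) x) ^+ 2))).
Proof.
rewrite -(@weighted_increment _ (@div_mx R) (S1 s0) 1).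
- by congr (_ * inner _ _ _); apply/funext => x; rewrite scale1r.
- exact: S1_diff.
- exact: div_mx_lincomb.
- exact: bounded_measurable_S1.
- by move=> m; exact: bounded_measurable_div.
Qed.

Lemma H2_increment L2 s0 : H2 Omega L2 s0 Q n phi =
  L2 * (dt^-1 / 2 *
   (integral_on Omega (fun x =>
          fnorm (S1 s0 (Q n.+1 x) *m curl_mx (Q n.+1) x) ^+ 2) -
    integral_on Omega (fun x =>
          fnorm (S1 s0 (Q n x) *m curl_mx (Q n) x) ^+ 2))).
Proof.
rewrite -(@weighted_increment _ (@curl_mx R) (S1 s0) 1).
- by congr (_ * inner _ _ _); apply/funext => x; rewrite scale1r.
- exact: S1_diff.
- exact: curl_mx_lincomb.
- exact: bounded_measurable_S1.
- by move=> m; exact: bounded_measurable_curl.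
Qed.

Lemma H3_increment L3 s0 : H3 Omega L3 s0 Q n phi =
  L3 * (dt^-1 / 2 *
   (integral_on Omega (fun x =>
          fnorm (S2 s0 (Q n.+1 x) *m div_mx (Q n.+1) x) ^+ 2) -
    integral_on Omega (fun x => fnorm (S2 s0 (Q n x) *m div_mx (Q n) x) ^+ 2))).
Proof.
rewrite -(@weighted_increment _ (@div_mx R) (S2 s0) (-1)).
- by congr (_ * inner _ _ _); apply/funext => x; rewrite scaleN1r.
- exact: S2_diff.
- exact: div_mx_lincomb.
- exact: bounded_measurable_S2.
- by move=> m; exact: bounded_measurable_div.
Qed.

Lemma H4_increment L4 s0 : H4 Omega L4 s0 Q n phi =
  L4 * (dt^-1 / 2 *
   (integral_on Omega (fun x =>
          fnorm (S2 s0 (Q n.+1 x) *m curl_mx (Q n.+1) x) ^+ 2) -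
    integral_on Omega (fun x =>
          fnorm (S2 s0 (Q n x) *m curl_mx (Q n) x) ^+ 2))).
Proof.
rewrite -(@weighted_increment _ (@curl_mx R) (S2 s0) (-1)).
- by congr (_ * inner _ _ _); apply/funext => x; rewrite scaleN1r.
- exact: S2_diff.
- exact: curl_mx_lincomb.
- exact: bounded_measurable_S2.
- by move=> m; exact: bounded_measurable_curl.
Qed.

Lemma H5_increment L5 : H5 Omega L5 Q n phi =
  L5 * (dt^-1 / 2 *
   (integral_on Omega (fun x =>
          fnorm (Q n.+1 x) ^+ 2 * tnorm (grad (Q n.+1) x) ^+ 2) -
    integral_on Omega (fun x =>
          fnorm (Q n x) ^+ 2 * tnorm (grad (Q n) x) ^+ 2))).
Proof.
rewrite /H5; congr (_ * _).
have bt m := bounded_measurable_tnorm_sqr (bgQ m).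
have bf m := bounded_measurable_fnorm_sqr (bQ m).
have bavg (f g : R3 R -> R) : bounded_measurable U f -> bounded_measurable U g ->
    bounded_measurable U (fun x => 2^-1 * (f x + g x)).
  move=> bf' bg; apply: bounded_measurableM; first exact: bounded_measurable_cst.
  exact: bounded_measurableD.
rewrite -(@integral_increment _ _ _ (fun x =>
  frob ((2^-1 * (tnorm (grad (Q n.+1) x) ^+ 2 + tnorm (grad (Q n) x) ^+ 2)) *:
    midpoint Q n x) (phi x) +
  tdot ((2^-1 * (fnorm (Q n.+1 x) ^+ 2 + fnorm (Q n x) ^+ 2)) *:
    grad (midpoint Q n) x) (grad phi x))); first last.
- move=> x Ux; rewrite (grad_midpoint Ux) (grad_phi Ux).
  rewrite scaleNr -scalerBr -(scalerDr _ (grad (Q n.+1) x)).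
  exact: quartic_increment.
- exact: bounded_measurableM.
- exact: bounded_measurableM.
rewrite /inner /inner_tensor !(integral_on_element_interiors hv) -/U.
rewrite integral_onD//.
- apply: bounded_measurable_frob; last first.
    exact: (bounded_measurable_affine hv hO affine_on_phi).
  apply: bounded_measurable_mxZ; first exact: bavg.
  exact: (bounded_measurable_affine hv hO affine_on_midpoint).
- apply: bounded_measurable_tdot; last first.
    exact: (bounded_measurable_grad hv affine_on_phi).
  move=> k; rewrite (_ : (fun _ => _) = fun x =>
    (2^-1 * (fnorm (Q n.+1 x) ^+ 2 + fnorm (Q n x) ^+ 2)) *:
      grad (midpoint Q n) x k).
    apply: bounded_measurable_mxZ; first exact: bavg.
    exact: (bounded_measurable_grad hv affine_on_midpoint).
  by apply/funext => x; rewrite ffunE.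
Qed.

Lemma H6_increment a b c : H6 Omega a b c Q n phi =
  dt^-1 * (integral_on Omega (fun x => bulk a b c (Q n.+1 x)) -
           integral_on Omega (fun x => bulk a b c (Q n x))).
Proof.
apply: integral_increment.
- exact: bounded_measurable_bulk.
- exact: bounded_measurable_bulk.
move=> x /(element_interiors_sub hv) Ox.
by apply: bulk_increment; exact: symQ.
Qed.

Lemma energy_split L1 L2 L3 L4 L5 a b c m (s0 := s_eq a b c) :
  energy Omega L1 L2 L3 L4 L5 a b c (Q m) =
    L1 / 2 * integral_on Omega (fun x =>
          fnorm (S1 s0 (Q m x) *m div_mx (Q m) x) ^+ 2)
  + L2 / 2 * integral_on Omega (fun x =>
        fnorm (S1 s0 (Q m x) *m curl_mx (Q m) x) ^+ 2)
  + L3 / 2 * integral_on Omega (fun x =>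
        fnorm (S2 s0 (Q m x) *m div_mx (Q m) x) ^+ 2)
  + L4 / 2 * integral_on Omega (fun x =>
        fnorm (S2 s0 (Q m x) *m curl_mx (Q m) x) ^+ 2)
  + L5 / 2 * integral_on Omega (fun x =>
        fnorm (Q m x) ^+ 2 * tnorm (grad (Q m) x) ^+ 2)
  + integral_on Omega (fun x => bulk a b c (Q m x)).
Proof.
rewrite /energy -/s0 !(integral_on_element_interiors hv) -/U.
have bdiv := bounded_measurable_div (bgQ m).
have bcurl := bounded_measurable_curl (bgQ m).
have bS1 := bounded_measurable_S1 s0 m; have bS2 := bounded_measurable_S2 s0 m.
have b1 := bounded_measurable_fnorm_sqr (bounded_measurable_mxM bS1 bdiv).
have b2 := bounded_measurable_fnorm_sqr (bounded_measurable_mxM bS1 bcurl).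
have b3 := bounded_measurable_fnorm_sqr (bounded_measurable_mxM bS2 bdiv).
have b4 := bounded_measurable_fnorm_sqr (bounded_measurable_mxM bS2 bcurl).
have b5 := bounded_measurableM (bounded_measurable_fnorm_sqr (bQ m))
  (bounded_measurable_tnorm_sqr (bgQ m)).
have b6 := bounded_measurable_bulk a b c (bQ m).
have bZ k f : bounded_measurable U f -> bounded_measurable U (fun x => k * f x).
  by apply: bounded_measurableM; exact: bounded_measurable_cst.
rewrite -!integral_onZ// -!integral_onD//;
  try by repeat (first [apply: bounded_measurableD | apply: bZ]).
by apply: eq_integral_on => x _; rewrite -(mulrA (L5 / 2)).
Qed.

(** Tested against the difference quotient, H is an exact difference quotient of
    the energy; the factor 1/2 in front of each elastic density is the one
    produced by the discrete product rules. *)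
Lemma Hfun_increment L1 L2 L3 L4 L5 a b c :
  Hfun Omega L1 L2 L3 L4 L5 a b c Q n phi =
  dt^-1 * (energy Omega L1 L2 L3 L4 L5 a b c (Q n.+1) -
           energy Omega L1 L2 L3 L4 L5 a b c (Q n)).
Proof.
rewrite /Hfun H1_increment H2_increment H3_increment H4_increment H5_increment.
rewrite H6_increment !energy_split.
(* Stated for variables, so that [ring] does not compare integrals. *)
have alg (k l1 l2 l3 l4 l5 x1 y1 x2 y2 x3 y3 x4 y4 x5 y5 x6 y6 : R) :
    l1 * (k / 2 * (x1 - y1)) + l2 * (k / 2 * (x2 - y2)) + l3 * (k / 2 * (x3 - y3))
    + l4 * (k / 2 * (x4 - y4)) + l5 * (k / 2 * (x5 - y5)) + k * (x6 - y6) =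
    k * (l1 / 2 * x1 + l2 / 2 * x2 + l3 / 2 * x3 + l4 / 2 * x4 + l5 / 2 * x5 + x6 -
      (l1 / 2 * y1 + l2 / 2 * y2 + l3 / 2 * y3 + l4 / 2 * y4 + l5 / 2 * y5 + y6)).
  by ring.
exact: alg.
Qed.

End EnergyIncrement.

(** * The dissipation law *)

Lemma L2norm_sqr (R : realType) (Omega : set (R3 R)) (m n : nat)
  (A : R3 R -> 'M[R]_(m, n)) :
  L2norm Omega A ^+ 2 = inner Omega A A.
Proof.
by rewrite sqr_sqrtr//; apply: Rintegral_ge0 => p _; exact: frob_ge0.
Qed.

Theorem theorem3p2 (R : realType)
  (Omega : set (R3 R)) (hOmega : bounded_domain Omega)
  (L : nat) (v : 'I_L -> 'I_4 -> R3 R) (hv : triangulation Omega v)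
  (kappa : R) (hkappa : 0 < kappa) (hquasi : quasi_uniform kappa v)
  (L1 L2 L3 L4 L5 M dt a b c : R)
  (hL1 : 0 < L1) (hL2 : 0 < L2) (hL3 : 0 < L3) (hL4 : 0 < L4) (hL5 : 0 <= L5)
  (hM : 0 < M) (hdt : 0 < dt) (hc : 0 < c) (ha : a < b ^+ 2 / (27 * c))
  (G Gh : mxfield R)
  (hG : forall x, boundary Omega x -> sym_traceless (G x))
  (hGh : is_boundary_lift Omega v G Gh)
  (Q : nat -> mxfield R) (hQ : forall n, TG Omega v Gh (Q n))
  (hscheme : forall phi, T0 Omega v phi -> forall n,
     inner Omega (difference_quotient dt Q n) phi =
     - M * Hfun Omega L1 L2 L3 L4 L5 a b c Q n phi) :
  forall n,
    (energy Omega L1 L2 L3 L4 L5 a b c (Q n.+1) -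
     energy Omega L1 L2 L3 L4 L5 a b c (Q n)) / dt =
    - M^-1 * L2norm Omega (difference_quotient dt Q n) ^+ 2.
Proof.
have affQ m l : affine_on (tetrahedron (v l)) (Q m).
  have [A [[_ _ affA] _] <-] := hQ m; have [[_ _ affG] _] := hGh.
  have := affine_on_lincomb 1 1 (affA l) (affG l).
  by move=> [u [d uE]]; exists u, d => x Tx; rewrite -uE// !scale1r.
have symQ m x : Omega x -> (Q m x)^T = Q m x.
  move=> /subset_closure Ox.
  have [A [[_ sA _] _] <-] := hQ m; have [[_ sG _] _] := hGh.
  by rewrite linearD /= (sA x Ox).1 (sG x Ox).1.
have [_ _ _ bO] := hOmega.
move=> n; have T0phi := TG_difference_quotient dt (hQ n) (hQ n.+1).
rewrite L2norm_sqr hscheme// (Hfun_increment hv bO affQ symQ).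
by field; rewrite !gt_eqF.
Qed.
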